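(* Let $(\delta,K_1,K_2,C_0,C_1)$ be primitive admissible parameters, put $C=\min(C_0,C_1)$, and let $M$ be a magic parameter. Let $\mathbf{G}=(G,d)$ be a finite edge-labelled graph with all labels in $\{1,\dots,\delta\}$ which has a completion into $\mathcal A^\delta_{K_1,K_2,C_0,C_1}$, and let $\overline{\mathbf G}=(G,\bar d)$ be its completion with magic parameter $M$. Then $\overline{\mathbf G}\in\mathcal A^\delta_{K_1,K_2,C_0,C_1}$. Moreover, if $\mathbf G'=(G,d')\in \mathcal A^\delta_{K_1,K_2,C_0,C_1}$ is any completion of $\mathbf G$, then for every pair $u,v\in G$ one of the following holds: (1) $d'(u,v)\ge \bar d(u,v)\ge M$; (2) $d'(u,v)\le \bar d(u,v)\le M$; (3) the parameters satisfy Case (IIB), $d'(u,v)\neq M$ and $\bar d(u,v)=M-1$. Finally, every automorphism of $\mathbf G$ is also an automorphism of $\overline{\mathbf G}$.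
   Context: An edge-labelled graph is a pair $(G,d)$ where $d$ is a partial symmetric function from $G^2$ to $\mathbb N$ with $d(u,v)=0$ iff $u=v$; pairs where $d$ is defined are edges. A completion of $(G,d)$ into a class $\mathcal A$ of metric spaces is a metric space $(G,d')\in\mathcal A$ with $d'(u,v)=d(u,v)$ on all edges. An automorphism of $(G,d)$ is a bijection preserving definedness and values of $d$. For $\delta\ge 3$ and parameters $K_1,K_2,C_0,C_1$, $\mathcal A^\delta_{K_1,K_2,C_0,C_1}$ is the class of finite metric spaces with integer distances in $\{1,\dots,\delta\}$ such that for every triangle (three distinct points) with perimeter $p$ and shortest side $m$: if $p$ is odd then $2K_1<p<2K_2+2m$ and $p<C_1$; if $p$ is even then $p<C_0$. Write $C=\min(C_0,C_1)$, $C'=\max(C_0,C_1)$. The parameters are acceptable if $3\le\delta<\infty$; $1\le K_1\le K_2\le 2\delta$ or ($K_1=\infty$, $K_2=0$); $2\delta<C_0,C_1\le 3\delta+2$ with $C_0$ even and $C_1$ odd; and $C_1=2\delta+1$ if $K_1=\infty$. Acceptable parameters are admissible if one of: (I) $K_1=\infty$; (II) $K_1<\infty$, $C\le 2\delta+K_1$, $C=2K_1+2K_2+1$, $K_1+K_2\ge\delta$, $K_1+2K_2\le 2\delta-1$, and either (IIA) $C'=C+1$ or (IIB) $C'>C+1$, $K_1=K_2$, $3K_2=2\delta-1$; (III) $K_1<\infty$, $C>2\delta+K_1$, $K_1+2K_2\ge 2\delta-1$, $3K_2\ge 2\delta$, if $K_1+2K_2=2\delta-1$ then $C\ge 2\delta+K_1+2$,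 and if $C'>C+1$ then $C\ge 2\delta+K_2$. They are primitive if they are admissible in Case (II) or (III) and $C_0,C_1\ge 2\delta+2$. A magic parameter is an integer $M$ with $\max(K_1,\lceil\delta/2\rceil)\le M\le \min(K_2,\lfloor (C-\delta-1)/2\rfloor)$ such that additionally: in Case (III) with $K_1+2K_2=2\delta-1$ we have $M>K_1$; in Case (III) with $C'>C+1$ and $C=2\delta+K_2$ we have $M<K_2$. For $x\in\{1,\dots,\delta\}\setminus\{M\}$ let $\mathcal F^+_x=\{(a,b)\in\{1..\delta\}^2: a+b=x\}$, $\mathcal F^-_x=\{(a,b): |a-b|=x\}$, $\mathcal F^C_x=\{(a,b): C-1-a-b=x\}$; set $\mathbb F_M(x)=\mathcal F^+_x\cup\mathcal F^C_x$ if $x<M$ and $\mathbb F_M(x)=\mathcal F^-_x$ if $x>M$; set $t_M(x)=2x-1$ if $x<M$ and $t_M(x)=2(\delta-x)$ if $x>M$. The completion with magic parameter $M$ of $\mathbf G$ is defined as follows: $\mathbf G_1=\mathbf G$; for $k\ge1$, if no $x$ has $t_M(x)=k$ then $\mathbf G_{k+1}=\mathbf G_k$, and otherwise for $x=t_M^{-1}(k)$, $\mathbf G_{k+1}$ is obtained from $\mathbf G_k$ by giving length $x$ to every non-edge $\{u,v\}$ of $\mathbf G_k$ for which there are $w$ and $(a,b)\in\mathbb F_M(x)$ with $\{d_k(u,w),d_k(v,w)\}=\{a,b\}$ (no other edges added). In the limit graph, all remaining non-edges get length $M$. *)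

(* Defs.v *)
From mathcomp Require Import all_boot all_order ssralg ssrnum ssrint zify.

Set Implicit Arguments.
Unset Strict Implicit.
Unset Printing Implicit Defensive.

Import IntDist.

(* [K1 P = None] encodes K_1 = infinity. *)
Record params := Params {
  delta : nat;
  K1 : option nat;
  K2 : nat;
  C0 : nat;
  C1 : nat
}.

Definition Cmin (P : params) : nat := minn (C0 P) (C1 P).
Definition Cmax (P : params) : nat := maxn (C0 P) (C1 P).

Definition acceptable (P : params) : Prop :=
  [/\ 3 <= delta P,
      (if K1 P is Some k then [/\ 1 <= k, k <= K2 P & K2 P <= 2 * delta P]
       else K2 P = 0),
      2 * delta P < C0 P <= 3 * delta P + 2 /\ ~~ odd (C0 P),
      2 * delta P < C1 P <= 3 * delta P + 2 /\ odd (C1 P)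
    & K1 P = None -> C1 P = 2 * delta P + 1].

Definition case_I (P : params) : Prop := K1 P = None.

Definition case_II_common (P : params) (k : nat) : Prop :=
  [/\ Cmin P <= 2 * delta P + k,
      Cmin P = 2 * k + 2 * K2 P + 1,
      delta P <= k + K2 P
    & k + 2 * K2 P <= 2 * delta P - 1].

Definition case_IIA (P : params) : Prop :=
  exists2 k, K1 P = Some k &
    case_II_common P k /\ Cmax P = Cmin P + 1.

Definition case_IIB (P : params) : Prop :=
  exists2 k, K1 P = Some k &
    case_II_common P k /\
    [/\ Cmin P + 1 < Cmax P, k = K2 P & 3 * K2 P = 2 * delta P - 1].

Definition case_II (P : params) : Prop := case_IIA P \/ case_IIB P.

Definition case_III (P : params) : Prop :=
  exists2 k, K1 P = Some k &
    [/\ 2 * delta P + k < Cmin P,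
        2 * delta P - 1 <= k + 2 * K2 P,
        2 * delta P <= 3 * K2 P,
        k + 2 * K2 P = 2 * delta P - 1 -> 2 * delta P + k + 2 <= Cmin P
      & Cmin P + 1 < Cmax P -> 2 * delta P + K2 P <= Cmin P].

Definition admissible (P : params) : Prop :=
  acceptable P /\ [\/ case_I P, case_II P | case_III P].

Definition primitive_params (P : params) : Prop :=
  [/\ admissible P,
      case_II P \/ case_III P,
      2 * delta P + 2 <= C0 P
    & 2 * delta P + 2 <= C1 P].

(* No integer bounds K_1 = infinity from above, hence the [None] branch. *)
Definition magic (P : params) (M : nat) : Prop :=
  if K1 P is Some k then
    [/\ maxn k (uphalf (delta P)) <= M,
        M <= minn (K2 P) ((Cmin P - delta P - 1) %/ 2),
        case_III P -> k + 2 * K2 P = 2 * delta P - 1 -> k < M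
      & case_III P -> Cmin P + 1 < Cmax P -> Cmin P = 2 * delta P + K2 P ->
          M < K2 P]
  else False.

Definition is_metric (T : Type) (d : T -> T -> nat) : Prop :=
  [/\ forall u v, d u v = 0 <-> u = v,
      forall u v, d u v = d v u
    & forall u v w, d u w <= d u v + d v w].

Definition triangle_ok (P : params) (a b c : nat) : Prop :=
  let p := a + b + c in
  let m := minn a (minn b c) in
  if odd p then
    [/\ (if K1 P is Some k then 2 * k < p else False),
        p < 2 * K2 P + 2 * m
      & p < C1 P]
  else p < C0 P.

Definition in_class (P : params) (T : finType) (d : T -> T -> nat) : Prop :=
  [/\ is_metric d,
      forall u v, d u v <= delta P
    & forall u v w, u <> v -> v <> w -> u <> w ->
        triangle_ok P (d u v) (d v w) (d u w)].

(* A partial function is an [option]-valued one; [None] marks a non-edge.  The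
   diagonal is always defined, with value 0. *)
Definition is_graph (T : finType) (d : T -> T -> option nat) : Prop :=
  (forall u v, d u v = d v u) /\ (forall u v, d u v = Some 0 <-> u = v).

Definition labels_in (D : nat) (T : finType) (d : T -> T -> option nat) : Prop :=
  forall u v x, u <> v -> d u v = Some x -> 1 <= x <= D.

Definition completion_of (P : params) (T : finType)
    (d : T -> T -> option nat) (d' : T -> T -> nat) : Prop :=
  in_class P d' /\ forall u v x, d u v = Some x -> d' u v = x.

(* With [L := option nat], preserving [e] means preserving both definedness and
   values; [L := nat] is the case of a complete graph. *)
Definition automorphism (T : finType) (L : Type) (e : T -> T -> L)
    (f : T -> T) : Prop :=
  bijective f /\ forall u v, e (f u) (f v) = e u v.

Section MagicCompletion.
Variables (P : params) (M : nat).
Local Notation D := (delta P).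

Definition in_range (ab : nat * nat) : bool :=
  (1 <= ab.1 <= D) && (1 <= ab.2 <= D).

Definition Fplus (x : nat) : pred (nat * nat) :=
  [pred ab | in_range ab && (ab.1 + ab.2 == x)].

Definition Fminus (x : nat) : pred (nat * nat) :=
  [pred ab | in_range ab && (`|ab.1 - ab.2|%N == x)].

(* C - 1 - a - b = x, without truncated subtraction. *)
Definition FC (x : nat) : pred (nat * nat) :=
  [pred ab | in_range ab && (Cmin P == x + ab.1 + ab.2 + 1)].

Definition FM (x : nat) : pred (nat * nat) :=
  if x < M then [pred ab | Fplus x ab || FC x ab] : pred _ else Fminus x.

Definition tM (x : nat) : nat :=
  if x < M then 2 * x - 1 else 2 * (D - x).

Definition tM_dom (x : nat) : bool := (1 <= x <= D) && (x != M).

Definition tM_inv (k : nat) : option nat :=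
  ohead [seq x <- iota 1 D | tM_dom x && (tM x == k)].

Lemma tM_inj : {in tM_dom &, injective tM}.
Proof.
move=> x y; rewrite !unfold_in /tM_dom /tM => Hx Hy.
by case: ifP => h1; case: ifP => h2; lia.
Qed.

Lemma tM_invP (k x : nat) : tM_inv k = Some x <-> tM_dom x /\ tM x = k.
Proof.
rewrite /tM_inv; set s := filter _ _.
have mem y : (y \in s) = tM_dom y && (tM y == k).
  rewrite mem_filter mem_iota /tM_dom; lia.
split=> [|[Dx tx]].
  case: s mem => //= y s' mem [<-]; move: (mem y).
  by rewrite mem_head => /esym/andP[-> /eqP].
have := mem x; rewrite Dx tx eqxx /=; case: s mem => //= y s' mem _.
have := mem y; rewrite mem_head => /esym/andP[Dy /eqP ty].
by congr Some; apply: tM_inj; rewrite // tx.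
Qed.

Section Stages.
Variables (T : finType) (d : T -> T -> option nat).

Definition witnessed (g : T -> T -> option nat) (x : nat) (u v : T) : bool :=
  [exists w, if (g u w, g v w) is (Some a, Some b)
             then ((a, b) \in FM x) || ((b, a) \in FM x) else false].

Definition step (k : nat) (g : T -> T -> option nat) (u v : T) : option nat :=
  if g u v is Some y then Some y
  else if tM_inv k is Some x then
    if witnessed g x u v then Some x else None
  else None.

(* [stage k] is G_k for k >= 1; [stage 0] is a dummy. *)
Fixpoint stage (k : nat) : T -> T -> option nat :=
  if k is (k'.+1 as j).+1 then step j (stage j) else d.

(* t_M only takes values below 2 delta, so the sequence is constant from there
   on; see [stage_stable]. *)
Definition limit_graph : T -> T -> option nat := stage (2 * D).

Lemma stage_stable (k : nat) (u v : T) :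
  2 * D <= k -> stage k u v = limit_graph u v.
Proof.
rewrite /limit_graph => /subnK <-; elim: (k - _) => // n <-.
rewrite addSn; case E: (n + 2 * D) => [|j] //=.
rewrite {1}/step; case: (_ u v) => //.
case Ei: (tM_inv j.+1) => [x|] //.
by move/tM_invP: Ei; rewrite /tM_dom /tM; case: ifP => _ []; lia.
Qed.

Definition magic_completion (u v : T) : nat := odflt M (limit_graph u v).

End Stages.
End MagicCompletion.

(* Main.v *)
Require Import Defs.
From mathcomp Require Import all_boot zify.

(**
Fix a completion d' of G in the class.  Every label l <> M that the algorithm
adds at a pair (u, v) comes from a fork (u, w), (v, w) whose labels are not M
and were added earlier (or belong to G), so a statement about single labels can
be proved by induction on time along forks.  The comparison of l with d'(u, v)
is of that kind, but it does not suffice: the conditions defining the class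
depend on the parity of perimeters, and l and d'(u, v) may differ in parity.
The induction therefore also carries bounds on l + d'(u, w) + d'(v, w), for an
arbitrary vertex w, when that sum has the dangerous parity; all of F^+, F^- and
F^C preserve them, because if a sum around a 4-cycle has a given parity then one
of the two triangles obtained from a diagonal carries it.

A triangle of the completion is then compared with the triangle of d' on the
same vertices.  If its perimeter is odd, then so is the perimeter of the d'
triangle or of one obtained from it by restoring a single completed label, which
the induction controls.  The remaining violations are excluded by closure: a
pair that is not an edge of G is settled no later than any fork over it demands.

In Case (IIB) F^C only produces the label M - 1, from a fork (delta, delta); this
label occurs in no further fork, but d' may exceed it, so that triangles through
it need a separate argument.
*)

Set Implicit Arguments.
Unset Strict Implicit.
Unset Printing Implicit Defensive.

(** * Numerical conditions on parameters, triangles, forks and labels *)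

(* Case (IIB), where the bounds on a magic parameter leave only M = K_1 = K_2. *)
Definition exceptional (P : params) (M k : nat) : Prop :=
  Cmin P = 4 * M + 1 /\ Cmin P + 1 < Cmax P /\ k = M /\ K2 P = M /\
  3 * M + 1 = 2 * delta P.

(* What the primitive parameters and M satisfy, with [k] for K_1: the three
   alternatives are the Cases (IIA), (IIB) and (III). *)
Definition regime (P : params) (M k : nat) : Prop :=
  (3 <= delta P /\ M <= delta P /\ 2 * delta P + 2 <= Cmin P /\
   1 <= k <= M /\ M <= K2 P /\ delta P <= 2 * M /\ 2 * M + delta P + 1 <= Cmin P /\
   ~~ odd (C0 P) /\ odd (C1 P)) /\
  ((Cmin P <= 2 * delta P + k /\ Cmin P = 2 * k + 2 * K2 P + 1 /\
    delta P <= k + K2 P /\ k + 2 * K2 P <= 2 * delta P - 1 /\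
    C0 P = C1 P + 1) \/
   exceptional P M k \/
   (2 * delta P + k < Cmin P /\
    (2 * delta P <= k + 2 * K2 P \/
     k + 2 * K2 P = 2 * delta P - 1 /\ 2 * delta P + k + 2 <= Cmin P /\
     k < M) /\
    2 * delta P <= 3 * K2 P /\
    (Cmax P = Cmin P + 1 \/ 2 * delta P + K2 P < Cmin P \/
     Cmin P = 2 * delta P + K2 P /\ M < K2 P))).

Definition good_triangle (P : params) (k a b c : nat) : Prop :=
  (a <= b + c /\ b <= a + c /\ c <= a + b /\
   a <= delta P /\ b <= delta P /\ c <= delta P) /\
  (odd (a + b + c) ->
    2 * k < a + b + c /\ a + b < 2 * K2 P + c /\ b + c < 2 * K2 P + a /\
    a + c < 2 * K2 P + b /\ a + b + c < C1 P) /\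
  (~~ odd (a + b + c) -> a + b + c < C0 P).

Definition fork (P : params) (M x a b : nat) : Prop :=
  (1 <= x <= delta P /\ 1 <= a <= delta P /\ 1 <= b <= delta P) /\
  (x < M /\ (a + b = x \/ Cmin P = x + a + b + 1) \/
   M < x /\ (a = b + x \/ b = a + x)).

(* The invariant carried along forks: l is the completed label of a pair (u, v),
   e = d'(u, v), and x = d'(u, w), y = d'(v, w) for an arbitrary vertex w.  The
   disjunct k <= l allows for F^C in Case (III), whose labels are at least k. *)
Definition label_inv (P : params) (M k l e x y : nat) : Prop :=
  (M < l -> l <= e /\ (odd (l + e) -> l + e < 2 * K2 P) /\
    (Cmin P + 1 < Cmax P -> odd (l + x + y) = odd (Cmin P) ->
     l + x + y < Cmin P)) /\
  (l < M -> (e <= l \/ exceptional P M k /\ l.+1 = M /\ M < e /\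
      (odd (l + x + y) -> x <= y + l /\ y <= x + l)) /\
    (odd (l + x + y) ->
     x + y < 2 * K2 P + l /\ (k <= l \/ 2 * k < l + x + y))).

(** * Forks, their times and elementary bounds *)

Lemma regime_gap P M k : regime P M k -> Cmin P + 1 < Cmax P ->
  2 * delta P + K2 P <= Cmin P.
Proof.
case=> _ [[_ [_ [_ [_ E]]]]|[X|[_ [_ [_ X]]]]].
- by rewrite /Cmin /Cmax; lia.
(* Equality holds here: 2 delta = 3M + 1 and K2 = M give 2 delta + K2 = 4M + 1 = C. *)
- by move: X; rewrite /exceptional; lia.
- by lia.
Qed.

(** This makes induction on [tM] possible. For F^C it rests on C >= 2 delta + 2: from a + b = C - 1
    - x and b <= delta follows delta - a < x. *)
Lemma fork_time P M k x a b : regime P M k -> fork P M x a b ->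
  [/\ a <> M, b <> M, tM P M a < tM P M x & tM P M b < tM P M x].
Proof.
rewrite /fork /tM => -[R _] [? H].
by case: (ltnP x M) => ?; case: (ltnP a M) => ?; case: (ltnP b M) => ? /=;
  split; lia.
Qed.

Lemma good_le P k a b c : good_triangle P k a b c ->
  (a <= b + c /\ b <= a + c /\ c <= a + b) /\
  a <= delta P /\ b <= delta P /\ c <= delta P.
Proof. by case; lia. Qed.

Lemma good_odd P k a b c : good_triangle P k a b c -> odd (a + b + c) ->
  2 * k < a + b + c /\ a + b < 2 * K2 P + c /\ b + c < 2 * K2 P + a /\
  a + c < 2 * K2 P + b /\ a + b + c < C1 P.
Proof. by case=> _ []. Qed.

Lemma good_even P k a b c : good_triangle P k a b c -> ~~ odd (a + b + c) ->
  a + b + c < C0 P.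
Proof. by case=> _ []. Qed.

Lemma good_perm P k a b c : good_triangle P k a b c -> good_triangle P k b a c.
Proof. by rewrite /good_triangle (addnC b a); lia. Qed.

Lemma label_inv_big P M k l e x y : label_inv P M k l e x y -> M < l ->
  l <= e /\ (odd (l + e) -> l + e < 2 * K2 P) /\
    (Cmin P + 1 < Cmax P -> odd (l + x + y) = odd (Cmin P) ->
     l + x + y < Cmin P).
Proof. by case. Qed.

Lemma label_inv_small P M k l e x y : label_inv P M k l e x y -> l < M ->
 (e <= l \/ exceptional P M k /\ l.+1 = M /\ M < e /\
      (odd (l + x + y) -> x <= y + l /\ y <= x + l)) /\
    (odd (l + x + y) ->
     x + y < 2 * K2 P + l /\ (k <= l \/ 2 * k < l + x + y)).
Proof. by case. Qed.

(** With a = M - 1, F^C would need b >= 2M + 2 and F^- would need b >= 2M, both beyond delta = (3M +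
    1) / 2. Hence exceptional labels never feed another fork. *)
Lemma fork_neq_pred P M k x a b : regime P M k -> fork P M x a b ->
  exceptional P M k -> a.+1 <> M.
Proof. by rewrite /exceptional /fork => -[R _] F E; lia. Qed.

Lemma fork_sym P M x a b : fork P M x a b -> fork P M x b a.
Proof. by rewrite /fork; lia. Qed.

Lemma label_inv_sym P M k l e x y :
  label_inv P M k l e x y -> label_inv P M k l e y x.
Proof.
rewrite /label_inv (addnAC l y x) (addnC y x) => -[Ib Is]; split=> // lM.
have [Ie Io] := Is lM; split=> //; case: Ie => [|[? [? [? H]]]]; first by left.
by right; do 3!split=> //; move=> /H[].
Qed.

Lemma fork_small P M k x a b e p q : regime P M k -> fork P M x a b ->
  a < M -> label_inv P M k a e p q -> e <= a.
Proof.
move=> R F aM A; have [[//|[E [h _]]] _] := label_inv_small A aM.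
by case: (fork_neq_pred R F E); lia.
Qed.

(** Either l + e is odd and the invariant combines with the triangle inequality, or e + x + y is odd
    and the class bound combines with l <= e. *)
Lemma label_inv_K2 P M k l e x y :
  label_inv P M k l e x y -> M < l -> good_triangle P k e x y ->
  odd (l + x + y) -> l + x < 2 * K2 P + y /\ l + y < 2 * K2 P + x.
Proof.
move=> I lM G O; have [le [p _]] := label_inv_big I lM; have Gl := good_le G.
have [h|h] := boolP (odd (l + e)); first by have := p h; lia.
have h2: odd (e + x + y) by lia.
by have := good_odd G h2; lia.
Qed.

(** * Preservation of the invariant by F^+, F^C and F^- *)

Lemma label_inv_plus P M k l a b e a' b' x y z :
  regime P M k -> fork P M l a b -> l < M -> a + b = l ->
  good_triangle P k e a' b' -> good_triangle P k a' x z ->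
  good_triangle P k b' y z ->
  label_inv P M k a a' x z -> label_inv P M k b b' y z ->
  label_inv P M k l e x y.
Proof.
move=> R F lM E Ge Ga Gb A B; split; first lia; move=> _.
have aM : a < M by lia.
have bM : b < M by lia.
have ea := fork_small R F aM A; have eb := fork_small R (fork_sym F) bM B.
have [_ {}A] := label_inv_small A aM; have [_ {}B] := label_inv_small B bM.
have {}Ge := good_le Ge; have {}Ga := good_le Ga; have {}Gb := good_le Gb.
split=> [|O]; first by left; lia.
have [Oa|Ob] : odd (a + x + z) \/ odd (b + y + z) by lia.
- by have {A B} := A Oa; lia.
- by have {A B} := B Ob; lia.
Qed.

(** Since C - 1 = 2k + 2 K2, the K2 bound of the odd triangle turns into the K1 bound for l by the
    triangle inequality in the other triangle, and into the K2 bound for l by the perimeter bound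
    there. *)
Lemma label_inv_C_IIA P M k l a b e a' b' x y z :
  regime P M k -> fork P M l a b -> l < M -> Cmin P = l + a + b + 1 ->
  Cmin P = 2 * k + 2 * K2 P + 1 -> C0 P = C1 P + 1 ->
  good_triangle P k e a' b' -> good_triangle P k a' x z ->
  good_triangle P k b' y z ->
  label_inv P M k a a' x z -> label_inv P M k b b' y z ->
  label_inv P M k l e x y.
Proof.
move=> [R _] [F _] lM E EC E01 Ge Ga Gb A B; split; first lia; move=> _.
have aM : M < a by lia.
have bM : M < b by lia.
have [ea _] := label_inv_big A aM; have [eb _] := label_inv_big B bM.
have perim p q r : good_triangle P k p q r -> p + q + r < Cmin P.
  move=> G; rewrite /Cmin.
  have [h|h] := boolP (odd (p + q + r)); first by have := good_odd G h; lia.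
  by have := good_even G h; lia.
have {}Ge := perim _ _ _ Ge.
have Pa := perim _ _ _ Ga; have Pb := perim _ _ _ Gb.
have Ta := good_le Ga; have Tb := good_le Gb.
split=> [|O]; first by left; lia.
have [Oa|Ob] : odd (a + x + z) \/ odd (b + y + z) by lia.
- by have := label_inv_K2 A aM Ga Oa; lia.
- by have := label_inv_K2 B bM Gb Ob; lia.
Qed.

Lemma label_inv_C_IIB P M k l a b e a' b' x y z :
  regime P M k -> fork P M l a b -> l < M -> Cmin P = l + a + b + 1 ->
  exceptional P M k ->
  good_triangle P k e a' b' -> good_triangle P k a' x z ->
  good_triangle P k b' y z ->
  label_inv P M k a a' x z -> label_inv P M k b b' y z ->
  label_inv P M k l e x y.
Proof.
move=> [R _] [F _] lM E X Ge Ga Gb A B; split; first lia; move=> _.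
have Y := X; rewrite /exceptional in X.
have aD : a = delta P by lia.
have bD : b = delta P by lia.
have EC1 : C1 P = Cmin P by rewrite /Cmin /Cmax in X *; lia.
have aM : M < a by lia.
have bM : M < b by lia.
have [ea _] := label_inv_big A aM; have [eb _] := label_inv_big B bM.
have Te := good_le Ge; have Ta := good_le Ga; have Tb := good_le Gb.
have {ea} ea : a' = delta P by lia.
have {eb} eb : b' = delta P by lia.
subst a b a' b'; clear A B.
have K : odd (l + x + y) ->
    [/\ x <= y + l, y <= x + l, x + y < 2 * K2 P + l & 2 * k < l + x + y].
  move=> O; have [Oa|Ob] : odd (delta P + x + z) \/ odd (delta P + y + z) by lia.
  - by have := good_odd Ga Oa; split; lia.
  - by have := good_odd Gb Ob; split; lia.
split.
  have [|eM] := leqP e l; [by left | right].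
  (* The value e = M is excluded: M is odd, so M + 2 delta = 4M + 1 = C1 would be an odd
     perimeter. *)
  have {}eM : M < e.
    have [//|eM'] := ltnP M e; have O : odd (e + delta P + delta P) by lia.
    by have := good_odd Ge O; lia.
  split=> //; split; first lia; split=> // O.
  by case: (K O); lia.
by move=> /K[? ? ? ?]; lia.
Qed.

(** Every F^C label is now at least C - 1 - 2 delta >= k, and 2 delta <= 2 K2 + l; the case x + y =
    2 K2 + l would make l + x + y even. *)
Lemma label_inv_C_III P M k l a b e a' b' x y z :
  regime P M k -> fork P M l a b -> l < M -> Cmin P = l + a + b + 1 ->
  2 * delta P + k < Cmin P ->
  good_triangle P k e a' b' -> good_triangle P k a' x z ->
  good_triangle P k b' y z ->
  label_inv P M k a a' x z -> label_inv P M k b b' y z ->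
  label_inv P M k l e x y.
Proof.
move=> [R R'] [F _] lM E X Ge Ga Gb A B; split; first lia; move=> _.
have aM : M < a by lia.
have bM : M < b by lia.
have [ea _] := label_inv_big A aM; have [eb _] := label_inv_big B bM.
have Te := good_le Ge; have Ta := good_le Ga; have Tb := good_le Gb.
rewrite /exceptional in R'.
(* If C' > C + 1, the lower bound on C would push an F^C label up to at least M. *)
have EC : Cmax P = Cmin P + 1 by lia.
split.
  left; rewrite /Cmax /Cmin in EC E.
  have [h|h] := boolP (odd (e + a' + b')); first by have := good_odd Ge h; lia.
  by have := good_even Ge h; lia.
by move=> O; lia.
Qed.

(** The last hypothesis takes an end of the pair itself as third vertex; it bounds an odd l + e when
    a + a' is even. *)
Lemma label_inv_minus P M k l a b e a' b' x y z :
  regime P M k -> fork P M l a b -> M < l -> a = b + l ->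
  good_triangle P k e a' b' -> good_triangle P k a' x z ->
  good_triangle P k b' y z -> good_triangle P k e x y ->
  label_inv P M k a a' x z -> label_inv P M k b b' y z ->
  label_inv P M k b b' e a' ->
  label_inv P M k l e x y.
Proof.
move=> R F lM E Ge Ga Gb G A B B2.
have aM : M < a by lia.
have bM : b < M by case: R F => R _ [F _]; lia.
have eb := fork_small R (fork_sym F) bM B.
have [ea [A1 A2]] := label_inv_big A aM; have [_ {}B] := label_inv_small B bM.
have [_ {}B2] := label_inv_small B2 bM.
have Te := good_le Ge; have Ta := good_le Ga.
have Tb := good_le Gb; have T := good_le G.
split; last lia; move=> _; split; first lia; split.
  move=> O.
  have [h|h] := boolP (odd (a + a')).
    by have := A1 h; lia.
  have [h2|h2] := boolP (odd (b + e + a')).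
    by have := B2 h2; lia.
  by lia.
move=> X O.
have [h|h] := boolP (odd (a + x + z) == odd (Cmin P)).
  by have := A2 X (eqP h); lia.
have h2 : odd (b + y + z) by lia.
have := B h2.
(* As y - b <= z, the K2 bound gives y - b < K2, so l + x + y = a + x + (y - b) < 2 delta + K2 <=
   C. *)
have := regime_gap R X; case: F => F _.
by clear - F E eb Tb T; lia.
Qed.

(** * Triangles of the completion: the triangle inequality *)

(* c, a, b are the completed labels of (u, v), (u, w), (v, w), and c', x, y their
   d' distances; c = c' covers the edges of G, the second disjunct is closure. *)
Definition completed_edge (P : params) (M k a b c c' x y : nat) : Prop :=
  [/\ c = c' \/ (forall z, fork P M z a b -> c <> M /\ tM P M c <= tM P M z),
      (1 <= c <= delta P) && (1 <= c') & c <> M -> label_inv P M k c c' x y].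

(** Closure at z = a + b, with [tM] unfolded on each side of M. The next two lemmas do the same for
    z = C - 1 - a - b and z = a - b. *)
Lemma edge_plus P M k a b c c' x y : completed_edge P M k a b c c' x y ->
  1 <= a -> 1 <= b -> M <= delta P -> a + b < M -> c = c' \/ c < M /\ c <= a + b \/
  M < c /\ delta P < c + a + b.
Proof.
move=> [[->|H] hc _] a0 b0 MD h; [by left | right].
case: (H (a + b)) => [|cM]; first by rewrite /fork; lia.
by rewrite /tM h; case: ltnP; lia.
Qed.

Lemma edge_C P M k a b c c' x y : completed_edge P M k a b c c' x y ->
  1 <= a <= delta P -> 1 <= b <= delta P -> M <= delta P ->
  a + b + 1 < Cmin P < a + b + 1 + M -> c = c' \/ c < M /\ c + a + b < Cmin P \/
  M < c /\ delta P + a + b + 1 < c + Cmin P.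
Proof.
move=> [[->|H] hc _] a0 b0 MD h; [by left | right].
case: (H (Cmin P - 1 - a - b)) => [|cM]; first by rewrite /fork; lia.
rewrite /tM; have -> : Cmin P - 1 - a - b < M by lia.
by case: ltnP; lia.
Qed.

Lemma edge_minus P M k a b c c' x y : completed_edge P M k a b c c' x y ->
  a <= delta P -> 1 <= b -> b + M < a -> c = c' \/ c < M /\ c + a <= delta P + b \/
  M < c /\ a <= b + c.
Proof.
move=> [[->|H] hc _] a0 b0 h; [by left | right].
case: (H (a - b)) => [|cM]; first by rewrite /fork; lia.
rewrite /tM; have -> : (a - b < M) = false by lia.
by case: ltnP; lia.
Qed.

(** Purely numerical, so that swapping and rotating reduces each bound to one arrangement of the
    sides. *)
Definition completed_triangle (P : params) (M k a a' b b' c c' : nat) : Prop :=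
  [/\ completed_edge P M k b c a a' b' c', completed_edge P M k a c b b' a' c',
      completed_edge P M k a b c c' a' b' & good_triangle P k a' b' c'].

Lemma edge_sym P M k a b c c' x y :
  completed_edge P M k a b c c' x y -> completed_edge P M k b a c c' y x.
Proof.
case=> H1 H2 H3; split=> //; last by move=> /H3/label_inv_sym.
by case: H1 => [|H1]; [left | right=> z /fork_sym; apply: H1].
Qed.

Lemma triangle_swap P M k a a' b b' c c' :
  completed_triangle P M k a a' b b' c c' ->
  completed_triangle P M k b b' a a' c c'.
Proof. by case=> ? ? /edge_sym ? /good_perm ?. Qed.

Lemma good_rot P k a b c : good_triangle P k a b c -> good_triangle P k b c a.
Proof. by rewrite /good_triangle (_ : b + c + a = a + b + c); lia. Qed.

Lemma triangle_rot P M k a a' b b' c c' :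
  completed_triangle P M k a a' b b' c c' ->
  completed_triangle P M k b b' c c' a a'.
Proof. by case=> ? /edge_sym ? /edge_sym ? /good_rot ?. Qed.

Lemma edge_cases P M k a b c c' x y : completed_edge P M k a b c c' x y ->
  c = c' \/ c = M \/ M < c <= c' \/ c' <= c < M \/
  exceptional P M k /\ c.+1 = M /\ M < c' /\
    (odd (c + x + y) -> x <= y + c /\ y <= x + c).
Proof.
case=> H1 H2 H3; have [|cM] := eqVneq c M; first tauto.
have I : label_inv P M k c c' x y by apply: H3; apply/eqP.
have [lt|ge] := ltnP c M; last by have := label_inv_big I; lia.
have [[h|h] _] := label_inv_small I lt; last tauto.
by right; right; right; left; lia.
Qed.

Lemma edge_range P M k a b c c' x y : completed_edge P M k a b c c' x y ->
  (1 <= c <= delta P) && (1 <= c').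
Proof. by case. Qed.

Lemma edge_small P M k a b c c' x y : completed_edge P M k a b c c' x y -> c < M ->
  odd (c + x + y) -> x + y < 2 * K2 P + c /\ (k <= c \/ 2 * k < c + x + y).
Proof. by case=> _ _ H cM; have /H/label_inv_small/(_ cM)[] : c <> M by lia. Qed.

Lemma edge_big P M k a b c c' x y : completed_edge P M k a b c c' x y -> M < c ->
  odd (c + c') -> c + c' < 2 * K2 P.
Proof. by case=> _ _ H cM; have /H/label_inv_big/(_ cM)[_ []] : c <> M by lia. Qed.

Lemma exceptional_C1 P M k : regime P M k -> exceptional P M k -> C1 P = 4 * M + 1.
Proof. by rewrite /exceptional /Cmin /Cmax => -[R _] E; lia. Qed.

(** If c >= M + b, then a' > M makes a' + c' exceed 2M + b, against the K2 bound of an odd triangle;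
    the other parities fall to the hypothesis on a + b' + c' or to closure. *)
Lemma triangle_metric_exc P M k a a' b b' c c' :
  regime P M k -> completed_triangle P M k a a' b b' c c' ->
  exceptional P M k -> a.+1 = M -> M < a' ->
  (odd (a + b' + c') -> b' <= c' + a /\ c' <= b' + a) -> c <= a + b.
Proof.
move=> R [A B C G] E aM a'M H; rewrite leqNgt; apply/negP => h.
have a0 := edge_range A; have b0 := edge_range B; have c0 := edge_range C.
have T := good_le G.
have bD := edge_cases B; have cD := edge_cases C.
have EC := exceptional_C1 R E; case: R => R _; rewrite /exceptional in E.
have bM : b < M by lia.
have cM : M < c by lia.
have cc' : c <= c' by lia.
have pc : ~~ odd (c + c') by apply/negP => O; have := edge_big C cM O; lia.
have B1 := edge_small B bM.
have A1 := edge_minus (edge_sym A).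
rewrite /exceptional in bD.
have oM : odd M by clear - E; lia.
have oa : ~~ odd a by clear - aM oM; lia.
(* Otherwise b is an exceptional label too, which forces M = 3 and delta = 5. *)
have bb' : b' <= b.
  case: bD => [|[|[|[|[_ [bM1 [b'M _]]]]]]]; try (clear - bM; lia).
  have [M3 b2] : M = 3 /\ b = 2 by clear - E R bM1 aM h c0 oM; lia.
  have [D5 c5] : delta P = 5 /\ c = 5 by clear - E M3 aM b2 h c0; lia.
  have [r|r] := boolP (odd (a' + b')).
    have [/B1|] : odd (b + a' + c') \/ odd (a + b' + c').
        by clear - r oa b2 cc' c5 D5 T; lia.
      by clear - E T M3 b2 D5 c5 a'M b'M cc' r; lia.
    have /(edge_small A) J : a < M by clear - aM; lia.
    by move/J; clear - E T M3 b2 aM D5 c5 a'M b'M cc' r; lia.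
  have /(good_odd G) : odd (a' + b' + c') by clear - r cc' c5 D5 T; lia.
  by clear - M3 EC b'M a'M cc' c5 T D5; lia.
clear bD; have [p|p] := boolP (odd (b + c)).
  have [q|q] := boolP (odd (b + b')).
    have [r|r] := boolP (odd a').
      have : odd (a' + b' + c') by clear - p q r pc; lia.
      by move=> /(good_odd G); clear - bb' E T aM bM cM cc' h a'M; lia.
    have : odd (b + a' + c') by clear - p r pc; lia.
    by move=> /B1; clear - bb' E T aM bM cM cc' h a'M; lia.
  have /H : odd (a + b' + c') by clear - p q oa pc; lia.
  by clear - bb' E R T aM bM cM cc' h a'M c0; lia.
(* M is odd and b + c even, so c > b + M: the fork (b, c) demands c - b before M - 1 can be
   added. *)
by have := A1 _ _ _; clear - E R aM oM a'M b0 c0 h p; lia.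
Qed.

(** Apart from exceptional labels, a completed length lies between M and the d' length. A failure
    thus needs a side differing from its d' length, and closure under the fork opposite to it
    applies. *)
Lemma triangle_metric P M k a a' b b' c c' :
  regime P M k -> completed_triangle P M k a a' b b' c c' -> c <= a + b.
Proof.
move=> R S; rewrite leqNgt; apply/negP => h.
have X1 := triangle_metric_exc R S; have X2 := triangle_metric_exc R (triangle_swap S).
case: S => A B C G.
have a0 := edge_range A; have b0 := edge_range B; have c0 := edge_range C.
have T := good_le G.
have aD : a = a' \/ a = M \/ M < a <= a' \/ a' <= a < M.
  case: (edge_cases A) => [|[|[|[|[E [? [? H]]]]]]]; try tauto.
  by have := X1 E; lia.
have bD : b = b' \/ b = M \/ M < b <= b' \/ b' <= b < M.
  case: (edge_cases B) => [|[|[|[|[E [? [? H]]]]]]]; try tauto.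
  by have := X2 E; lia.
have cD : c = c' \/ c <= M \/ M < c <= c'.
  by case: (edge_cases C); lia.
case: R => R _.
have C1 := edge_plus C.
have A1 := edge_minus (edge_sym A); have B1 := edge_minus (edge_sym B).
by clear - a0 b0 c0 T aD bD cD R C1 A1 B1 h; lia.
Qed.

(** * Upper bounds on perimeters *)

Definition perim_ok (P : params) (s : nat) : Prop :=
  (odd s = odd (Cmin P) -> s < Cmin P) /\ s < Cmax P.

Lemma perim_okP P s : ~~ odd (C0 P) -> odd (C1 P) ->
  perim_ok P s <-> (odd s -> s < C1 P) /\ (~~ odd s -> s < C0 P).
Proof. by rewrite /perim_ok /Cmin /Cmax => h0 h1; split; lia. Qed.

Lemma good_perim P M k a b c :
  regime P M k -> good_triangle P k a b c -> perim_ok P (a + b + c).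
Proof.
move=> [R _] [_ [Go Ge]]; apply/perim_okP; [lia | lia |].
by split=> [/Go|/Ge]; lia.
Qed.

(** As C >= 2M + delta + 1, a perimeter of at least C leaves at most one side up to M. The other two
    do not exceed their d' lengths, and closure under F^C controls the shortest side. *)
Lemma triangle_perim_flat P M k a a' b b' c c' :
  regime P M k -> Cmax P = Cmin P + 1 -> completed_triangle P M k a a' b b' c c' ->
  c <= a -> c <= b -> perim_ok P (a + b + c).
Proof.
move=> R E [A B C G] ca cb.
have S1 : a' + b' + c' < Cmin P.
  by have [] := good_perim R G; rewrite E; lia.
suff h : a + b + c < Cmin P by rewrite /perim_ok; lia.
have a0 := edge_range A; have b0 := edge_range B; have c0 := edge_range C.
have aD := edge_cases A; have bD := edge_cases B; have cD := edge_cases C.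
have C1 := edge_C C; case: R => R _.
rewrite /exceptional in aD bD cD.
rewrite ltnNge; apply/negP => h.
have {}aD : M < a -> a <= a' by clear - aD; lia.
have {}bD : M < b -> b <= b' by clear - bD; lia.
have {}cD : M < c -> c <= c' by clear - cD; lia.
by clear - aD bD cD C1 a0 b0 c0 S1 h R ca cb; lia.
Qed.

Lemma edge_bigC P M k a b c c' x y : completed_edge P M k a b c c' x y -> M < c ->
  Cmin P + 1 < Cmax P -> odd (c + x + y) = odd (Cmin P) -> c + x + y < Cmin P.
Proof. by case=> _ _ H cM; have /H/label_inv_big/(_ cM)[_ [_]] : c <> M by lia. Qed.

Lemma triangle_perim_gap P M k a a' b b' c c' :
  regime P M k -> Cmin P + 1 < Cmax P -> completed_triangle P M k a a' b b' c c' ->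
  c <= a -> c <= b -> perim_ok P (a + b + c).
Proof.
move=> R E [A B C G] ca cb.
have [S1 S2] := good_perim R G; have gap := regime_gap R E.
have a0 := edge_range A; have b0 := edge_range B; have c0 := edge_range C.
have aD := edge_cases A; have bD := edge_cases B; have cD := edge_cases C.
rewrite /exceptional in aD bD cD.
have {}aD : M < a -> a <= a' by clear - aD; lia.
have {}bD : M < b -> b <= b' by clear - bD; lia.
have {}cD : M < c -> c <= c' by clear - cD; lia.
have C1 := edge_C C.
have [cM|cM] := ltnP M c; last first.
  case: R => R R'; rewrite /exceptional in R'.
  (* Now a + b + c <= 2 delta + M <= C, so only equality throughout can fail. *)
  have [//|h] : perim_ok P (a + b + c) \/
      a = delta P /\ b = delta P /\ c = M /\ Cmin P = 2 * delta P + M.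
    by clear - R gap E cM a0 b0; rewrite /perim_ok; lia.
  have C3 : c = c' by clear - C1 h R; lia.
  have [Ta Tb] := (good_le G).2.
  suff [-> ->] : a = a' /\ b = b' by rewrite C3.
  by clear - aD bD h R Ta Tb; lia.
have aM : M < a by lia.
have bM : M < b by lia.
have {}aD := aD aM; have {}bD := bD bM; have {}cD := cD cM.
split; last by clear - aD bD cD S2; lia.
move=> O; have [q|q] := eqVneq (odd (a' + b' + c')) (odd (Cmin P)).
  by have := S1 q; lia.
(* The three mixed sums add up to a + b + c modulo 2, so they cannot all miss the parity of C. *)
have [p|[p|p]] : odd (a + b' + c') = odd (Cmin P) \/
    odd (b + a' + c') = odd (Cmin P) \/ odd (c + a' + b') = odd (Cmin P).
  by clear - O q; lia.
- by have := edge_bigC A aM E p; clear - aD bD cD; lia.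
- by have := edge_bigC B bM E p; clear - aD bD cD; lia.
- by have := edge_bigC C cM E p; clear - aD bD cD; lia.
Qed.

Lemma regime_C P M k : regime P M k -> Cmax P = Cmin P + 1 \/ Cmin P + 1 < Cmax P.
Proof. by case=> R _; rewrite /Cmin /Cmax; lia. Qed.

Lemma triangle_perim P M k a a' b b' c c' :
  regime P M k -> completed_triangle P M k a a' b b' c c' ->
  perim_ok P (a + b + c).
Proof.
move=> R S.
have H x x' y y' z z' : completed_triangle P M k x x' y y' z z' ->
    z <= x -> z <= y -> perim_ok P (x + y + z).
  by case: (regime_C R) => [/triangle_perim_flat|/triangle_perim_gap]; eauto.
have [ca|ac] := leqP c a; have [cb|bc] := leqP c b.
- exact: H S _ _.
- have -> : a + b + c = c + a + b by lia.
  by apply: H (triangle_rot (triangle_rot S)) _ _; lia.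
- have -> : a + b + c = b + c + a by lia.
  by apply: H (triangle_rot S) _ _; lia.
- have [ab|ba] := leqP a b.
    have -> : a + b + c = b + c + a by lia.
    by apply: H (triangle_rot S) _ _; lia.
  have -> : a + b + c = c + a + b by lia.
  by apply: H (triangle_rot (triangle_rot S)) _ _; lia.
Qed.

(** * The K1 and K2 bounds on odd triangles *)

Lemma odd_sum_flip a a' b b' c c' : odd (a + b + c) ->
  [\/ odd (a' + b' + c'), odd (a + b' + c'), odd (b + a' + c') | odd (c + a' + b')].
Proof.
move=> O; have [q|q] := boolP (odd (a' + b' + c')); first exact: Or41.
have [p|p] := boolP (odd (a + b' + c')); first exact: Or42.
have [r|r] := boolP (odd (b + a' + c')); first exact: Or43.
by apply: Or44; lia.
Qed.

Lemma edge_small_cases P M k a b c c' x y : completed_edge P M k a b c c' x y -> c < M ->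
  c' <= c \/ exceptional P M k /\ c.+1 = M /\ M < c' /\
    (odd (c + x + y) -> x <= y + c /\ y <= x + c).
Proof. by case=> _ _ H cM; have /H/label_inv_small/(_ cM)[] : c <> M by lia. Qed.

(** M is odd here. With one exceptional side, a' <= b + c forces an even perimeter 2M; with two, the
    third side is 1; with three, 3(M - 1) is even. *)
Lemma triangle_K1_exc P M k a a' b b' c c' :
  completed_triangle P M k a a' b b' c c' ->
  exceptional P M k -> a.+1 = M -> M < a' ->
  b < M -> c < M -> odd (a + b + c) -> 2 * k < a + b + c.
Proof.
move=> [A B C G] E aM a'M bM cM O; rewrite ltnNge; apply/negP => h.
have b0 := edge_range B; have c0 := edge_range C.
have T := good_le G.
have A1 : odd (a + b' + c') -> b' <= c' + a /\ c' <= b' + a.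
  have /(edge_small_cases A) : a < M by lia.
  by case=> [|[_ [_ [_ H]]] /H]; clear - aM a'M; lia.
have EM : k = M /\ K2 P = M /\ odd M by case: E; lia.
have [bD|[_ [b1 [b'M B1]]]] := edge_small_cases B bM;
have [cD|[_ [c1 [c'M C1]]]] := edge_small_cases C cM.
- by clear - bD cD T aM EM h a'M O; lia.
- have {}C1 : ~~ odd (c + a' + b').
    by apply/negP=> /C1; clear - bD T aM EM c1 h a'M O; lia.
  have {}A1 : ~~ odd (a + b' + c').
    by apply/negP=> /A1; clear - bD T aM EM c1 c'M h a'M O; lia.
  have /(good_odd G) : odd (a' + b' + c').
    by clear - b0 A1 C1 O T bD aM EM c1 a'M h; lia.
  by clear - EM T aM c1 c'M a'M bD h O; lia.
- have {}B1 : ~~ odd (b + a' + c').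
    by apply/negP=> /B1; clear - cD T aM EM b1 h a'M O; lia.
  have {}A1 : ~~ odd (a + b' + c').
    by apply/negP=> /A1; clear - cD T aM EM b1 b'M h a'M O; lia.
  have /(good_odd G) : odd (a' + b' + c').
    by clear - c0 A1 B1 O T cD aM EM b1 a'M h; lia.
  by clear - EM T aM b1 b'M a'M cD h O; lia.
- by clear - b0 c0 b1 c1 aM EM O; lia.
Qed.

(** An odd perimeter below 2k forces all sides below k, hence below M, where returning to d' does
    not lengthen a side unless its label is exceptional. *)
Lemma triangle_K1 P M k a a' b b' c c' :
  regime P M k -> completed_triangle P M k a a' b b' c c' ->
  odd (a + b + c) -> 2 * k < a + b + c.
Proof.
move=> R S O; rewrite ltnNge; apply/negP => h.
have m1 := triangle_metric R S; have m2 := triangle_metric R (triangle_rot S).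
have m3 := triangle_metric R (triangle_rot (triangle_rot S)).
have F := odd_sum_flip a' b' c' O.
have [A B C G] := S; case: R => R _.
have [ak bk ck] : [/\ a < k, b < k & c < k].
  by clear - R m1 m2 m3 h O; split; lia.
have [aM bM cM] : [/\ a < M, b < M & c < M].
  by clear - R ak bk ck; split; lia.
have A1 := edge_small A aM; have B1 := edge_small B bM.
have C1 := edge_small C cM.
have [aD|[E [h1 [h2 _]]]] := edge_small_cases A aM; last first.
  by have := triangle_K1_exc S E h1 h2 bM cM O; rewrite ltnNge h.
have [bD|[E [h1 [h2 _]]]] := edge_small_cases B bM; last first.
  have := triangle_K1_exc (triangle_swap S) E h1 h2 aM cM.
  by rewrite (addnC b a) => /(_ O); rewrite ltnNge h.
have [cD|[E [h1 [h2 _]]]] := edge_small_cases C cM; last first.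
  have := triangle_K1_exc (triangle_rot (triangle_rot S)) E h1 h2 aM bM.
  by rewrite -addnA addnC => /(_ O); rewrite ltnNge h.
by case: F => [/(good_odd G)|/A1|/B1|/C1]; clear - ak bk ck aD bD cD h; lia.
Qed.

Lemma triangle_K2 P M k a a' b b' c c' :
  regime P M k -> completed_triangle P M k a a' b b' c c' ->
  odd (a + b + c) -> a + b < 2 * K2 P + c.
Proof.
move=> R S O; rewrite ltnNge; apply/negP => h.
have m1 := triangle_metric R S; have m2 := triangle_metric R (triangle_rot S).
have m3 := triangle_metric R (triangle_rot (triangle_rot S)).
have F := odd_sum_flip a' b' c' O.
have PP := triangle_perim R S.
case: S => A B C G; case: R => R R'.
have a0 := edge_range A; have b0 := edge_range B; have c0 := edge_range C.
have aM : M < a by clear - R m1 m2 m3 h O; lia.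
have bM : M < b by clear - R m1 m2 m3 h O; lia.
(* In Case (II) the perimeter bound limits c; in Case (III) a + b <= 2 delta does. *)
have cM : c < M.
  case: R' => [X|[X|X]].
  - by clear - R X h a0 b0 PP O; rewrite /perim_ok in PP; lia.
  - clear - R X h a0 b0 PP O.
    by rewrite /exceptional /perim_ok in X PP; lia.
  - by clear - R X h a0 b0 O; lia.
have aD : a <= a' by have := edge_cases A; clear - aM; lia.
have bD : b <= b' by have := edge_cases B; clear - bM; lia.
have A1 : odd (a + b' + c') -> a + b' < 2 * K2 P + c'.
  move=> o; case: A => _ _ A; have I : a <> M by lia.
  by have [] := label_inv_K2 (A I) aM G o.
have B1 : odd (b + a' + c') -> b + a' < 2 * K2 P + c'.
  move=> o; case: B => _ _ B; have I : b <> M by lia.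
  by have [] := label_inv_K2 (B I) bM (good_perm G) o.
have C1 := edge_small C cM.
have [X|[E [cM1 _]]] := edge_small_cases C cM.
  by case: F => [/(good_odd G)|/A1|/B1|/C1]; clear - R X aM bM cM aD bD h; lia.
rewrite /exceptional in E.
have pa : ~~ odd (a + a').
  by apply/negP => /(edge_big A aM); clear - E aD aM; lia.
have pb : ~~ odd (b + b').
  by apply/negP => /(edge_big B bM); clear - E bD bM; lia.
by clear - pa pb C1 O aD bD h E cM1; lia.
Qed.

Lemma triangle_good P M k a a' b b' c c' :
  regime P M k -> completed_triangle P M k a a' b b' c c' ->
  good_triangle P k a b c.
Proof.
move=> R S; have S2 := triangle_rot S; have S3 := triangle_rot S2.
have m1 := triangle_metric R S; have m2 := triangle_metric R S2.
have m3 := triangle_metric R S3.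
have K := triangle_K1 R S; have k1 := triangle_K2 R S.
have k2 := triangle_K2 R S2; have k3 := triangle_K2 R S3.
have [p0 p1] : (odd (a + b + c) -> a + b + c < C1 P) /\
               (~~ odd (a + b + c) -> a + b + c < C0 P).
  by apply/perim_okP; [case: R; lia | case: R; lia | exact: triangle_perim R S].
have [A B C _] := S.
have a0 := edge_range A; have b0 := edge_range B; have c0 := edge_range C.
rewrite (_ : b + c + a = a + b + c) in k2; last lia.
rewrite (_ : c + a + b = a + b + c) in k3; last lia.
split; first lia; split=> // O.
by have := K O; have := k1 O; have := k2 O; have := k3 O; have := p0 O; lia.
Qed.

(** * From the parameters and the class to the numerical conditions *)

Lemma primitive_regime P M : primitive_params P -> magic P M ->
  exists2 k, K1 P = Some k & regime P M k.
Proof.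
case=> [[[D3 aK [C0b C0e] [C1b C1o] _] _] cases C0p C1p].
rewrite /magic; case EK: (K1 P) aK => [k|] // [k0 kK2 KD] [M1 M2 M3 M4].
exists k => //; split.
  by rewrite uphalf_half in M1; rewrite /Cmin in M1 M2 *; lia.
rewrite /exceptional.
case: cases => [[|]|].
- case=> k'; rewrite EK => -[<-] [[c1 c2 c3 c4] c5]; left.
  by rewrite /Cmin /Cmax in c1 c2 c5 *; lia.
- case=> k'; rewrite EK => -[<-] [[c1 c2 c3 c4] [c5 c6 c7]].
  by right; left; rewrite /Cmin /Cmax in M1 M2 c1 c2 c5 *; lia.
- move=> c; have := c; case=> k'; rewrite EK => -[<-] [c1 c2 c3 c4 c5].
  right; right; have {}M3 := M3 c; have {}M4 := M4 c; split=> //; split.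
    by lia.
  split=> //.
  have : Cmax P = Cmin P + 1 \/ Cmin P + 1 < Cmax P by rewrite /Cmin /Cmax; lia.
  by lia.
Qed.

Lemma exceptional_case_IIB P M k : K1 P = Some k -> exceptional P M k -> case_IIB P.
Proof.
move=> EK; rewrite /exceptional => E; exists k => //.
by split; split; lia.
Qed.

(** Degenerate triples are included because the third vertex of the invariant is arbitrary; their
    even perimeter is at most 2 delta < C0. *)
Lemma in_class_good P k (T : finType) (d' : T -> T -> nat) u v w :
  K1 P = Some k -> 2 * delta P < C0 P -> in_class P d' ->
  good_triangle P k (d' u v) (d' u w) (d' v w).
Proof.
move=> EK C0D [[d0 ds dt] dD tri].
have d00 x : d' x x = 0 by apply/d0.
have deg x y : good_triangle P k (d' x y) (d' x y) 0.
  by have := dD x y; rewrite /good_triangle !addn0 addnn odd_double; lia.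
have [<-|uv] := eqVneq u v.
  by rewrite d00; do 2!apply/good_rot; exact: deg.
have [<-|uw] := eqVneq u w.
  by rewrite d00 (ds v u); apply/good_rot/good_perm/deg.
have [<-|vw] := eqVneq v w; first by rewrite d00; apply: deg.
have := tri u v w (elimN eqP uv) (elimN eqP vw) (elimN eqP uw).
have t1 := dt u v w; have t2 := dt v u w; have t3 := dt u w v.
have b1 := dD u v; have b2 := dD v w; have b3 := dD u w.
rewrite (ds v u) (ds w v) in t2 t3.
rewrite /triangle_ok EK /good_triangle (addnAC (d' u v)).
by case: ifP => O; [case=> ? ? ? | move=> ?]; split; lia.
Qed.

Lemma good_label_inv P M k e x y :
  regime P M k -> good_triangle P k e x y -> label_inv P M k e e x y.
Proof.
move=> R G; split=> h.
  split=> //; split; first by rewrite addnn odd_double.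
  by move=> _; case: (good_perim R G).
by split; [left | move=> /(good_odd G); lia].
Qed.

Lemma witnessedP P M (T : finType) (g : T -> T -> option nat) x u v :
  tM_dom P M x ->
  (exists w a b, [/\ g u w = Some a, g v w = Some b & fork P M x a b]) <->
  witnessed P M g x u v.
Proof.
move=> xM.
have E a b : fork P M x a b <-> ((a, b) \in FM P M x) || ((b, a) \in FM P M x).
  move: xM; rewrite /tM_dom /fork /FM; case: ifP => h;
  by rewrite !inE /Fplus /FC /Fminus /= /in_range /=; lia.
split=> [[w [a [b [ga gb /E F]]]]|/existsP[w]].
  by apply/existsP; exists w; rewrite ga gb.
case ga: (g u w) => [a|] //; case gb: (g v w) => [b|] // /E F.
by exists w, a, b.
Qed.

Lemma witnessed_sym P M (T : finType) (g : T -> T -> option nat) x u v :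
  witnessed P M g x u v = witnessed P M g x v u.
Proof.
apply: eq_existsb => w; case: (g u w) => [a|]; case: (g v w) => [b|] //.
exact: orbC.
Qed.

(** * Stages of the algorithm: timing, closure and symmetry *)

Section Stages.
Variables (P : params) (M : nat) (T : finType) (d : T -> T -> option nat).
Local Notation stage := (stage P M d).
Local Notation dbar := (magic_completion P M d).

Lemma stageSS j u v : stage j.+2 u v = step P M j.+1 (stage j.+1) u v.
Proof. by []. Qed.

Lemma stageS j u v y : stage j u v = Some y -> stage j.+1 u v = Some y.
Proof. by case: j => [|j] // h; rewrite stageSS /step h. Qed.

Lemma stage_le i j u v y : i <= j -> stage i u v = Some y -> stage j u v = Some y.
Proof.
by move=> /subnK <-; elim: (j - i) => // n IH /IH; rewrite addSn; apply: stageS.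
Qed.

Lemma stage_d j u v y : d u v = Some y -> stage j u v = Some y.
Proof. exact: (@stage_le 0). Qed.

(** Step k leads from G_k to G_(k+1), hence the successor. Positivity excludes x = delta > M, whose
    time 0 precedes G_1. *)
Lemma stage_witnessed x u v : tM_dom P M x -> 0 < tM P M x ->
  witnessed P M (stage (tM P M x)) x u v ->
  exists y, stage (tM P M x).+1 u v = Some y.
Proof.
move=> xM; case tx: (tM P M x) => [|j] // _ W.
have Ei : tM_inv P M j.+1 = Some x by apply/tM_invP.
rewrite stageSS /step Ei W.
by case: (stage j.+1 u v) => [y|]; [exists y | exists x].
Qed.

Lemma stageP j u v x : stage j u v = Some x ->
  d u v = Some x \/
  [/\ tM_dom P M x, tM P M x < j, stage (tM P M x).+1 u v = Some x
    & witnessed P M (stage (tM P M x)) x u v].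
Proof.
elim: j => [|j IH]; first by left.
case: j IH => [|j] IH; first by left.
rewrite stageSS {1}/step; case E: (stage j.+1 u v) => [y|].
  move=> [yx]; move: E; rewrite yx => /IH [|[]]; first by left.
  by move=> ? lt ? ?; right; split=> //; apply: ltnW.
case Ei: (tM_inv P M j.+1) => [y|] //; case: ifP => // W [yx].
rewrite {}yx in Ei W; have [xM tx] := (tM_invP P M j.+1 x).1 Ei.
right; rewrite tx; split=> //.
by rewrite stageSS /step E Ei W.
Qed.

Lemma mc_d u v x : d u v = Some x -> dbar u v = x.
Proof. by rewrite /magic_completion /limit_graph => /stage_d ->. Qed.

Lemma mc_limit u v : dbar u v <> M -> limit_graph P M d u v = Some (dbar u v).
Proof. by rewrite /magic_completion; case: (limit_graph _ _ _ _ _). Qed.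

Lemma mc_stage u v j : d u v = None -> dbar u v <> M -> tM P M (dbar u v) < j ->
  stage j u v = Some (dbar u v).
Proof.
move=> duv /mc_limit/stageP[|[_ _ H _] lt]; first by rewrite duv.
exact: stage_le H.
Qed.

Lemma mc_fork u v : d u v = None -> dbar u v <> M ->
  exists w, fork P M (dbar u v) (dbar u w) (dbar v w).
Proof.
move=> duv /mc_limit/stageP[|[xM lt H W]]; first by rewrite duv.
have [w [a [b [ga gb F]]]] := (@witnessedP P M T _ _ u v xM).2 W; exists w.
have le j p q y : j <= 2 * delta P -> stage j p q = Some y -> dbar p q = y.
  by move=> lj /(stage_le lj) E; rewrite /magic_completion /limit_graph E.
by rewrite (le _ _ _ _ (ltnW lt) ga) (le _ _ _ _ (ltnW lt) gb).
Qed.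

(** By [fork_time] both sides of the fork are present at stage [tM P M x], so the pair receives a
    label at that step unless it has one already. *)
Lemma mc_closed k x u v w : regime P M k -> d u v = None ->
  fork P M x (dbar u w) (dbar v w) ->
  dbar u v <> M /\ tM P M (dbar u v) <= tM P M x.
Proof.
move=> R duv F; have [aM bM ta tb] := fork_time R F.
have st p : dbar p w <> M -> tM P M (dbar p w) < tM P M x ->
    stage (tM P M x) p w = Some (dbar p w).
  move=> pM lt; case E: (d p w) => [y|]; last exact: mc_stage.
  by rewrite (mc_d E); apply: stage_d.
have xM : tM_dom P M x by case: F; rewrite /tM_dom; lia.
have [|y] := @stage_witnessed x u v xM (leq_ltn_trans (leq0n _) ta).
  apply/(@witnessedP P M T _ _ u v xM).
  by exists w, (dbar u w), (dbar v w); split; rewrite ?st.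
move=> E; have lt : tM P M x < 2 * delta P.
  by move: xM; rewrite /tM_dom /tM; case: ifP; lia.
have <- : y = dbar u v.
  by rewrite /magic_completion /limit_graph (stage_le lt E).
have [|[yM lt' _ _]] := stageP E; first by rewrite duv.
by split=> //; case/andP: yM => _ /eqP.
Qed.

Lemma mc_range : is_graph d -> labels_in (delta P) d -> 1 <= M <= delta P ->
  forall u v, u <> v -> 1 <= dbar u v <= delta P.
Proof.
move=> dG dL MD u v uv; have [->//|/eqP h] := eqVneq (dbar u v) M.
case/mc_limit/stageP: h => [|[]]; first exact: dL.
by case/andP.
Qed.

Lemma mc_diag u : is_graph d -> dbar u u = 0.
Proof. by case=> _ d0; apply: mc_d; apply/d0. Qed.

Lemma stage_sym : is_graph d -> forall j u v, stage j u v = stage j v u.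
Proof.
move=> [ds _]; elim=> [|[|j] IH] u v; [exact: ds | exact: ds |].
rewrite !stageSS /step IH.
by case: (tM_inv _ _ _) => [x|] //; rewrite witnessed_sym.
Qed.

Lemma mc_sym : is_graph d -> forall u v, dbar u v = dbar v u.
Proof. by move=> dG u v; rewrite /magic_completion /limit_graph stage_sym. Qed.

Lemma mc_automorphism f : automorphism d f -> automorphism dbar f.
Proof.
case=> bf fd; split=> //.
suff st j u v : stage j (f u) (f v) = stage j u v.
  by move=> u v; rewrite /magic_completion /limit_graph st.
elim: j u v => [|[|j] IH] u v; [exact: fd | exact: fd |].
rewrite !stageSS /step IH.
have [g fK gK] := bf.
have W x : witnessed P M (stage j.+1) x (f u) (f v) =
    witnessed P M (stage j.+1) x u v.
  apply/existsP/existsP => -[w H].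
    by exists (g w); rewrite -(IH u) -(IH v) gK.
  by exists (f w); rewrite !IH.
by case: (stage j.+1 u v) => //; case: (tM_inv _ _ _) => // x; rewrite W.
Qed.

End Stages.

(** * The invariant and the class conditions for the whole completion *)

Lemma label_inv_fork P M k l a b e a' b' x y z :
  regime P M k -> fork P M l a b ->
  good_triangle P k e a' b' -> good_triangle P k a' x z ->
  good_triangle P k b' y z -> good_triangle P k e x y ->
  label_inv P M k a a' x z -> label_inv P M k a a' e b' ->
  label_inv P M k b b' y z -> label_inv P M k b b' e a' ->
  label_inv P M k l e x y.
Proof.
move=> R F Ge Ga Gb G A A2 B B2; have [_ F'] := F.
case: F' => [[lM [E|E]]|[lM [E|E]]].
- exact: label_inv_plus R F lM E Ge Ga Gb A B.
- have [_ [[_ [X [_ [_ Y]]]]|[X|[X _]]]] := R.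
  + exact: label_inv_C_IIA R F lM E X Y Ge Ga Gb A B.
  + exact: label_inv_C_IIB R F lM E X Ge Ga Gb A B.
  + exact: label_inv_C_III R F lM E X Ge Ga Gb A B.
- exact: label_inv_minus R F lM E Ge Ga Gb G A B B2.
- apply: label_inv_sym; apply: label_inv_minus R (fork_sym F) lM E _ Gb Ga _ B A A2.
    exact: good_rot (good_perm Ge).
  exact: good_rot (good_perm G).
Qed.

Section Completion.
Variables (P : params) (M k : nat) (T : finType).
Variables (d : T -> T -> option nat) (d' : T -> T -> nat).
Hypotheses (EK : K1 P = Some k) (R : regime P M k).
Hypotheses (dG : is_graph d) (dL : labels_in (delta P) d).
Hypothesis d'C : completion_of P d d'.
Local Notation dbar := (magic_completion P M d).

Lemma completion_good u v w : good_triangle P k (d' u v) (d' u w) (d' v w).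
Proof.
case: d'C => d'A _; apply: in_class_good => //.
by case: R => -[_ [_ [h _]]] _; rewrite /Cmin in h; lia.
Qed.

Lemma completion_sym u v : d' u v = d' v u.
Proof. by case: d'C => -[[]]. Qed.

Lemma mc_label_inv u v w : dbar u v <> M ->
  label_inv P M k (dbar u v) (d' u v) (d' u w) (d' v w).
Proof.
(* The vertex w stays general: the invariant of a fork side is used both at w and at the opposite
   end of the pair. *)
have [n] := ubnP (tM P M (dbar u v)); elim: n => // n IH in u v w *.
rewrite ltnS => lt uvM; case duv: (d u v) => [x|].
  rewrite (mc_d P M duv) -(d'C.2 _ _ _ duv).
  exact: good_label_inv R (completion_good u v w).
have [z F] := mc_fork duv uvM; have [aM bM ta tb] := fork_time R F.
have IHu t := IH u z t (leq_trans ta lt) aM.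
have IHv t := IH v z t (leq_trans tb lt) bM.
apply: (label_inv_fork R F (a' := d' u z) (b' := d' v z) (z := d' z w)) => //;
  try exact: completion_good.
- by rewrite (completion_sym v z).
- by rewrite (completion_sym u v) (completion_sym u z).
Qed.

Lemma mc_edge u v w : u <> v ->
  completed_edge P M k (dbar u w) (dbar v w) (dbar u v)
    (d' u v) (d' u w) (d' v w).
Proof.
move=> uv; split; last exact: mc_label_inv.
  case duv: (d u v) => [x|]; last by right=> z /(mc_closed R duv).
  by left; rewrite (mc_d P M duv) (d'C.2 _ _ _ duv).
rewrite mc_range //=; last by case: R; lia.
by rewrite lt0n; apply/eqP; case: d'C => -[[d0 _ _] _ _] _ /d0.
Qed.

Lemma mc_good u v w : u <> v -> v <> w -> u <> w ->
  good_triangle P k (dbar u v) (dbar v w) (dbar u w).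
Proof.
move=> uv vw uw; apply: (triangle_good R (a' := d' u v) (b' := d' v w) (c' := d' u w)).
split; last exact: good_rot (good_perm (completion_good u v w)).
- exact/edge_sym/mc_edge.
- by rewrite (mc_sym P M dG u v) (mc_sym P M dG u w) (completion_sym u v)
    (completion_sym u w); apply: mc_edge.
- by rewrite (mc_sym P M dG v w) (completion_sym v w); apply: mc_edge.
Qed.

Lemma mc_in_class : in_class P dbar.
Proof.
have M0 : 1 <= M <= delta P by case: R; lia.
have r u v : u <> v -> 1 <= dbar u v <= delta P by exact: mc_range.
have r0 u v : dbar u v <= delta P.
  by have [->|/eqP/r/andP[]//] := eqVneq u v; rewrite mc_diag.
have sym := mc_sym P M dG.
split=> //; last first.
  move=> u v w uv vw uw; have G := mc_good uv vw uw; rewrite /triangle_ok EK.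
  case: ifPn => [/(good_odd G)|/(good_even G)] // H.
  by split; lia.
split=> // [u v|u v w].
  split=> [e0|->]; last exact: mc_diag.
  by have [//|/eqP/r] := eqVneq u v; rewrite e0.
have [->|/eqP uv] := eqVneq u v; first by rewrite mc_diag.
have [->|/eqP vw] := eqVneq v w; first by rewrite mc_diag // addn0.
have [->|/eqP uw] := eqVneq u w; first by rewrite mc_diag.
by have := good_le (mc_good uv vw uw); lia.
Qed.

Lemma mc_optimal u v :
  [\/ d' u v >= dbar u v /\ dbar u v >= M, d' u v <= dbar u v /\ dbar u v <= M
    | [/\ case_IIB P, d' u v <> M & dbar u v = M - 1]].
Proof.
have [->|/eqP uvM] := eqVneq (dbar u v) M.
  by have [?|?] := leqP M (d' u v); [apply: Or31 | apply: Or32; split=> //; lia].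
have I := mc_label_inv v uvM; have [lM|lM] := ltnP (dbar u v) M; last first.
  have {}lM : M < dbar u v by lia.
  by have [? _] := label_inv_big I lM; apply: Or31; lia.
have [[?|[E [? [? _]]]] _] := label_inv_small I lM; first by apply: Or32; lia.
apply: Or33; split; [exact: exceptional_case_IIB E | lia | lia].
Qed.

End Completion.

Theorem theorem4p16 (P : params) (M : nat) (T : finType)
    (d : T -> T -> option nat) :
  primitive_params P -> magic P M ->
  is_graph d -> labels_in (delta P) d ->
  (exists d0 : T -> T -> nat, completion_of P d d0) ->
  let dbar := magic_completion P M d in
  [/\ in_class P dbar,
      forall d' : T -> T -> nat, completion_of P d d' ->
        forall u v : T,
          [\/ d' u v >= dbar u v /\ dbar u v >= M,
              d' u v <= dbar u v /\ dbar u v <= M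
            | [/\ case_IIB P, d' u v <> M & dbar u v = M - 1]]
    & forall f : T -> T, automorphism d f -> automorphism dbar f].
Proof.
move=> prim mag dG dL [d0 d0C] dbar.
have [k EK R] := primitive_regime prim mag.
split; first exact: mc_in_class EK R dG dL d0C.
  by move=> d' d'C u v; apply: mc_optimal EK R d'C u v.
exact: mc_automorphism.
Qed.
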